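(* Let $\mathcal{D}=(\mathcal{P},\mathcal{L},\mathcal{I})$ be a Desargues affine plane and let $O,I\in\mathcal{P}$ be two different fixed points. Let $+$ be the addition on the set of points of the line $OI$ defined by the parallel-line construction. Then the groupoid $(OI,+)$ is a commutative (abelian) group.
   Context: An affine plane is an incidence structure $(\mathcal{P},\mathcal{L},\mathcal{I})$ (points, lines, incidence relation $\mathcal{I}\subseteq\mathcal{P}\times\mathcal{L}$) satisfying: (A1) for every two different points $P,Q$ there is exactly one line incident with both, denoted $PQ$; (A2) for every point $P$ and line $\ell$ with $(P,\ell)\notin\mathcal{I}$ there is exactly one line $r$ incident with $P$ such that $\ell\cap r=\varnothing$; (A3) there are three points not all incident with one line. Lines are identified with the sets of points incident with them, and $P\in\ell$ means $(P,\ell)\in\mathcal{I}$. Two lines $\ell,m$ are parallel, $\ell\parallel m$, if they coincide or have no common point; parallelism is an equivalence relation on $\mathcal{L}$. For a point $P$ and a line $AB$ ($A\neq B$), $\ell_{AB}^{P}$ denotes the unique line through $P$ parallel to $AB$ (so $\ell_{AB}^{P}=AB$ if $P\in AB$). A Desargues affine plane is an affine plane satisfying axiom (D1): if $AA_1$, $BB_1$, $CC_1$ are three different pairwise parallel lines (with $A\ne A_1$, $B\neq B_1$, $C\neq C_1$) and $AB\parallel A_1B_1$, $BC\parallel B_1C_1$, then $AC\parallel A_1C_1$. Addition on $OI$: for points $A,B\in OI$, choose an auxiliary point $B_1\in\mathcal{P}$ with $B_1\notin OI$; let $P_1$ be the point with $\ell_{OI}^{B_1}\cap\ell_{OB_1}^{A}=\{P_1\}$;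 and let $C$ be the point with $\ell_{BB_1}^{P_1}\cap OI=\{C\}$. The point $C$ exists, is unique, and does not depend on the choice of $B_1$; one sets $A+B:=C$. This gives a binary operation $+:OI\times OI\to OI$. *)

(* Defs.v *)
From mathcomp Require Import all_boot.
From mathcomp Require Import boolp.

Set Implicit Arguments.
Unset Strict Implicit.
Unset Printing Implicit Defensive.

Record affinePlane := AffinePlane {
  point : Type;
  line : Type;
  inc : point -> line -> Prop;
  A1 : forall P Q : point, P <> Q -> exists! l : line, inc P l /\ inc Q l;
  A2 : forall (P : point) (l : line), ~ inc P l ->
    exists! r : line, inc P r /\ ~ (exists X, inc X l /\ inc X r);
  A3 : exists P Q R : point, ~ (exists l, [/\ inc P l, inc Q l & inc R l])
}.

Arguments inc {a} P l.
Arguments A1 {a} P Q.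
Arguments A2 {a} P l.

Definition parallel (D : affinePlane) (l m : line D) : Prop :=
  l = m \/ ~ (exists X, inc X l /\ inc X m).

(* The intersection of l and m is the singleton {X}. *)
Definition meet_at (D : affinePlane) (l m : line D) (X : point D) : Prop :=
  forall Y, inc Y l /\ inc Y m <-> Y = X.

Definition join (D : affinePlane) (P Q : point D) (nPQ : P <> Q) : line D :=
  projT1 (cid (A1 P Q nPQ)).

Lemma parallel_through_exists (D : affinePlane) (P : point D) (l : line D) :
  exists! r : line D, inc P r /\ parallel r l.
Proof.
have [Pl|nPl] := pselect (inc P l).
  exists l; split=> [|r [Pr [->//|nX]]]; first by split=> //; left.
  by case: nX; exists P.
have [r [[Pr nX] r_uniq]] := A2 P l nPl.
exists r; split=> [|s [Ps [sl|nXs]]].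
- by split=> //; right=> -[X [? ?]]; apply: nX; exists X.
- by case: nPl; rewrite -sl.
- by apply: r_uniq; split=> // -[X [? ?]]; apply: nXs; exists X.
Qed.

Definition parallel_through (D : affinePlane) (P : point D) (l : line D) :
    line D :=
  projT1 (cid (parallel_through_exists P l)).

(* A <> B, B <> C, A <> C and A1 <> B1, B1 <> C1, A1 <> C1 follow from the three
   lines being pairwise disjoint; they are bound only to form the joins. *)
Definition D1 (D : affinePlane) : Prop :=
  forall (A A1 B B1 C C1 : point D)
    (nAA1 : A <> A1) (nBB1 : B <> B1) (nCC1 : C <> C1)
    (nAB : A <> B) (nA1B1 : A1 <> B1)
    (nBC : B <> C) (nB1C1 : B1 <> C1)
    (nAC : A <> C) (nA1C1 : A1 <> C1),
  [/\ join nAA1 <> join nBB1, join nBB1 <> join nCC1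
    & join nAA1 <> join nCC1] ->
  [/\ parallel (join nAA1) (join nBB1), parallel (join nBB1) (join nCC1)
    & parallel (join nAA1) (join nCC1)] ->
  parallel (join nAB) (join nA1B1) ->
  parallel (join nBC) (join nB1C1) ->
  parallel (join nAC) (join nA1C1).

Record desarguesPlane := DesarguesPlane {
  desargues_affine :> affinePlane;
  desarguesP : D1 desargues_affine
}.

Definition points_on (D : affinePlane) (l : line D) := {X : point D | inc X l}.

Lemma join_incl (D : affinePlane) (P Q : point D) (n : P <> Q) :
  inc P (join n).
Proof. by rewrite /join; case: cid => l [[]]. Qed.

Lemma join_incr (D : affinePlane) (P Q : point D) (n : P <> Q) :
  inc Q (join n).
Proof. by rewrite /join; case: cid => l [[]]. Qed.

Lemma inc_neq (D : affinePlane) (l : line D) (P Q : point D) :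
  inc P l -> ~ inc Q l -> P <> Q.
Proof. by move=> Pl nQl PQ; apply: nQl; rewrite -PQ. Qed.

Definition sum_construction (D : affinePlane) (O I : point D) (nOI : O <> I)
    (A B : points_on (join nOI)) (B1 : point D) (nB1 : ~ inc B1 (join nOI))
    (C : points_on (join nOI)) : Prop :=
  let OI := join nOI in
  let OB1 := join (inc_neq (join_incl nOI) nB1) in
  let BB1 := join (inc_neq (proj2_sig B) nB1) in
  exists P1 : point D,
    meet_at (parallel_through B1 OI) (parallel_through (proj1_sig A) OB1) P1 /\
    meet_at (parallel_through P1 BB1) OI (proj1_sig C).

Lemma parallel_throughP (D : affinePlane) (P : point D) (l : line D) :
  inc P (parallel_through P l) /\ parallel (parallel_through P l) l.
Proof. by rewrite /parallel_through; case: cid => r []. Qed.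

Lemma parallel_sym (D : affinePlane) (l m : line D) :
  parallel l m -> parallel m l.
Proof. by case=> [->|n]; [left|right=> -[X [? ?]]; apply: n; exists X]. Qed.

Lemma parallel_trans (D : affinePlane) (l m n : line D) :
  parallel l m -> parallel m n -> parallel l n.
Proof.
move=> lm mn; have [[X [Xl Xn]]|] := pselect (exists X, inc X l /\ inc X n);
  last by right.
left; have [r [_ r_uniq]] := parallel_through_exists X m.
rewrite -(r_uniq l (conj Xl lm)); apply: r_uniq.
by split=> //; apply: parallel_sym.
Qed.

Lemma meet_exists (D : affinePlane) (l m : line D) :
  ~ parallel l m -> exists X, meet_at l m X.
Proof.
move=> nlm; have [X [Xl Xm]] : exists X, inc X l /\ inc X m.
  by apply: contrapT => n; apply: nlm; right.
exists X => Y; split=> [[Yl Ym]|->//].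
apply: contrapT => nYX; apply: nlm; left.
have [k [_ k_uniq]] := A1 Y X nYX.
by rewrite -(k_uniq l (conj Yl Xl)) (k_uniq m (conj Ym Xm)).
Qed.

Lemma join_nparallel (D : affinePlane) (l : line D) (P Q : point D)
    (n : P <> Q) : inc P l -> ~ inc Q l -> ~ parallel (join n) l.
Proof.
move=> Pl nQl [e|nX]; first by apply: nQl; rewrite -e; apply: join_incr.
by apply: nX; exists P; split=> //; apply: join_incl.
Qed.

Lemma outside_exists (D : affinePlane) (l : line D) :
  exists P : point D, ~ inc P l.
Proof.
apply: contrapT => n; have [P [Q [R []]]] := A3 D.
by exists l; split; apply: contrapT => nl; apply: n; eexists; exact: nl.
Qed.

Lemma sum_construction_exists (D : affinePlane) (O I : point D) (nOI : O <> I)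
    (A B : points_on (join nOI)) (B1 : point D) (nB1 : ~ inc B1 (join nOI)) :
  exists C, sum_construction A B nB1 C.
Proof.
rewrite /sum_construction.
have nO := @join_nparallel _ _ _ _ (inc_neq (join_incl nOI) nB1)
  (join_incl nOI) nB1.
have nB := @join_nparallel _ _ _ _ (inc_neq (proj2_sig B) nB1)
  (proj2_sig B) nB1.
have [P1 P1P] : exists P1, meet_at (parallel_through B1 (join nOI))
    (parallel_through (proj1_sig A) (join (inc_neq (join_incl nOI) nB1))) P1.
  apply: meet_exists => p; apply: nO.
  apply: parallel_trans (proj2 (parallel_throughP B1 _)).
  apply: parallel_sym; apply: parallel_trans p _.
  exact: proj2 (parallel_throughP _ _).
have [C CP] : exists C, meet_at
    (parallel_through P1 (join (inc_neq (proj2_sig B) nB1))) (join nOI) C.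
  apply: meet_exists => p; apply: nB; apply: parallel_trans p.
  by apply: parallel_sym; exact: proj2 (parallel_throughP _ _).
by exists (exist _ C (proj2 (proj2 (CP C) erefl))), P1.
Qed.

Lemma sum_exists (D : affinePlane) (O I : point D) (nOI : O <> I)
    (A B : points_on (join nOI)) :
  exists C, exists (B1 : point D) (nB1 : ~ inc B1 (join nOI)),
    sum_construction A B nB1 C.
Proof.
have [B1 nB1] := outside_exists (join nOI).
by have [C CP] := sum_construction_exists A B nB1; exists C, B1, nB1.
Qed.

(* The auxiliary point B1 is chosen arbitrarily, possibly depending on A and
   B; in a Desargues plane the result does not depend on it. *)
Definition add (D : affinePlane) (O I : point D) (nOI : O <> I)
    (A B : points_on (join nOI)) : points_on (join nOI) :=
  projT1 (cid (sum_exists A B)).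

Definition abelian_group (T : Type) (op : T -> T -> T) : Prop :=
  [/\ associative op, commutative op
    & exists e : T, [/\ left_id e op, right_id e op
        & forall x, exists y, op x y = e /\ op y x = e]].

(* Main.v *)
Require Import Defs.
From mathcomp Require Import all_boot.
From mathcomp Require Import boolp.

Set Implicit Arguments.
Unset Strict Implicit.
Unset Printing Implicit Defensive.

(** A + B is the image of B under the translation taking O to A: in the
construction, P1 is the image of B1 and C is the image of B
([sum_constructionE]). This settles the independence of B1, and A |-> (the
translation taking O to A) turns + into composition. So (OI, +) is an abelian
group once translations are known to exist for all pairs of points, to be
determined by the image of one point, to be closed under composition and to
commute.

A translation is here a map sending each line into a parallel one, which is
the identity as soon as it fixes a point. Uniqueness, closure
and commutation rest on one fact, valid in any affine plane: if f moves one
point along a line l, then it moves every point along the parallel to l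
([translation_traces]). Uniqueness and closure follow from it by intersecting
lines. Two translations in
different directions commute because both composites complete the same
parallelogram; two in the same direction are compared through a third one in
another direction.

Existence ([translation_exists]) is where the Desargues axiom enters, as a
transitivity law for parallelograms X X' Y' Y on three parallel lines. The
axiom says nothing about pairs lying on only two lines. Such pairs are compared
through a third line when there is one; when there is none, each of the two
lines has only two points ([covered_line]) and the claim is checked by
cases. *)

(** * Lines of an affine plane *)

Section Incidence.
Variable D : affinePlane.
Implicit Types (P Q X Y : point D) (l m n : line D).

Lemma meet_unique l m P Q :
  l <> m -> inc P l -> inc P m -> inc Q l -> inc Q m -> P = Q.
Proof.
move=> nlm Pl Pm Ql Qm; apply: contrapT => nPQ; apply: nlm.
have [k [_ k_uniq]] := A1 P Q nPQ.
by rewrite -(k_uniq l (conj Pl Ql)) (k_uniq m (conj Pm Qm)).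
Qed.

Lemma line_unique l m P Q :
  P <> Q -> inc P l -> inc Q l -> inc P m -> inc Q m -> l = m.
Proof.
by move=> nPQ Pl Ql Pm Qm; apply: contrapT => /meet_unique/(_ Pl Pm Ql Qm).
Qed.

Lemma line_through P Q : P <> Q -> exists l, inc P l /\ inc Q l.
Proof. by case/A1=> l [? _]; exists l. Qed.

Lemma joinE l P Q (nPQ : P <> Q) : inc P l -> inc Q l -> join nPQ = l.
Proof.
by move=> Pl Ql; apply: (line_unique nPQ) => //;
  [apply: join_incl | apply: join_incr].
Qed.

Lemma parallel_exists P l : exists m, inc P m /\ parallel m l.
Proof. by exists (parallel_through P l); apply: parallel_throughP. Qed.

Lemma parallel_eq l m P : parallel l m -> inc P l -> inc P m -> l = m.
Proof. by case=> // n Pl Pm; case: n; exists P. Qed.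

Lemma parallel_notin l m P : parallel l m -> l <> m -> inc P l -> ~ inc P m.
Proof. by move=> lm nlm Pl /(parallel_eq lm Pl). Qed.

Lemma crossing l m : ~ parallel l m -> exists X, inc X l /\ inc X m.
Proof. by case/meet_exists=> X XP; exists X; apply/XP. Qed.

Lemma not_parallel l m P Q :
  inc P l -> inc P m -> inc Q m -> ~ inc Q l -> ~ parallel l m.
Proof.
by move=> Pl Pm Qm nQl /parallel_eq/(_ Pl Pm) e; apply: nQl; rewrite e.
Qed.

(** Planes of order 2, where the Desargues axiom says nothing, enter only
through this lemma: if X were a third point of l, then the line through B
parallel to KX would meet AK outside l and m. *)
Lemma covered_line l m A B K X :
  parallel l m -> l <> m -> (forall P, inc P l \/ inc P m) ->
  A <> B -> inc A l -> inc B l -> inc K m -> inc X l -> X = A \/ X = B.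
Proof.
move=> lm nlm cov nAB Al Bl Km Xl.
apply: contrapT => /not_orP[nXA nXB].
have nKl : ~ inc K l.
  by apply: parallel_notin Km; [exact: parallel_sym | exact: nesym].
have nAK : A <> K by move=> e; apply: nKl; rewrite -e.
have nXK : X <> K by move=> e; apply: nKl; rewrite -e.
have [n [An Kn]] := line_through nAK.
have [p [Xp Kp]] := line_through nXK.
have nnl : n <> l by move=> e; apply: nKl; rewrite -e.
have npl : p <> l by move=> e; apply: nKl; rewrite -e.
have [r [Br rp]] := parallel_exists B p.
have nrn : ~ parallel r n.
  move=> rn; have pn : p = n.
    exact: parallel_eq (parallel_trans (parallel_sym rp) rn) Kp Kn.
  by rewrite pn in Xp; apply: nXA; exact: (meet_unique nnl).
have [Y [Yr Yn]] := crossing nrn.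
have [Yl|Ym] := cov Y.
- have YA : Y = A by exact: (meet_unique nnl).
  rewrite {}YA in Yr Yn.
  have rl : r = l by exact: (line_unique nAB).
  by apply: npl; apply: parallel_eq Xp Xl; rewrite -rl; apply: parallel_sym.
- have nnm : n <> m.
    by move=> e; apply: nlm; apply: parallel_eq lm Al _; rewrite -e.
  have YK : Y = K by exact: (meet_unique nnm).
  rewrite {}YK in Yr Yn.
  have rep : r = p by exact: parallel_eq rp Yr Kp.
  by rewrite rep in Br; apply: nXB; exact: (meet_unique npl).
Qed.

End Incidence.

(** * Translations *)

Section Translations.
Variable D : affinePlane.
Implicit Types (P Q X Y Z : point D) (l m n : line D).
Implicit Types (f g h : point D -> point D).

Definition dilatation f := forall l m X Y,
  parallel l m -> inc X l -> inc Y l -> inc (f X) m -> inc (f Y) m.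

(** Constant maps are dilatations in the above sense; the condition on fixed
points rules them out here, along with the homotheties. *)
Definition translation f :=
  dilatation f /\ forall X, f X = X -> f = id.

Definition preserves f l := forall X, inc X l -> inc (f X) l.

Definition traces f l := forall m, parallel m l -> preserves f m.

Lemma translation_id : translation id.
Proof. by split=> // l m X Y lm Xl Yl Xm; rewrite -(parallel_eq lm Xl Xm). Qed.

Lemma dilatation_comp f g : dilatation f -> dilatation g -> dilatation (f \o g).
Proof.
move=> df dg l m X Y lm Xl Yl fgXm /=.
have [k [gXk km]] := parallel_exists (g X) m.
have lk : parallel l k by apply: parallel_trans lm (parallel_sym km).
exact: df km gXk (dg _ _ _ _ lk Xl Yl gXk) fgXm.
Qed.

Lemma dilatation_preserves f l X :
  dilatation f -> inc X l -> inc (f X) l -> preserves f l.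
Proof. by move=> df Xl fXl Y Yl; apply: df Xl Yl fXl; left. Qed.

Lemma traces_id l : traces id l.
Proof. by move=> m _ Y. Qed.

Lemma traces_parallel f l m : parallel l m -> traces f m -> traces f l.
Proof. by move=> lm fm n nl; apply: fm; apply: parallel_trans nl lm. Qed.

(** If some Y left its parallel to l, the line joining Y and f Y would meet l;
both lines are preserved, so their meeting point would be fixed. *)
Lemma translation_traces f l X :
  translation f -> inc X l -> inc (f X) l -> traces f l.
Proof.
move=> [df fix_id] Xl fXl m ml Y Ym.
have [fY|nfY] := pselect (f Y = Y); first by rewrite fY.
apply: contrapT => nfYm.
have [n [Yn fYn]] := line_through nfY.
have nml : ~ parallel n l.
  move=> nl; apply: nfYm.
  rewrite -(parallel_eq (parallel_trans nl (parallel_sym ml)) _ Ym) //.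
have [Z [Zn Zl]] := crossing nml.
have fZl := dilatation_preserves df Xl fXl Zl.
have fZn : inc (f Z) n by apply: (dilatation_preserves df) Zn; eassumption.
have nnl : n <> l by move=> e; apply: nml; left.
have fZ : f Z = Z by exact: (meet_unique nnl).
by apply: nfY; rewrite (fix_id Z fZ).
Qed.

(** f Y is the point where m meets the parallel through f Z to the line YZ, so
it is determined by f Z. *)
Lemma dilatations_agree_on f g m Z :
  dilatation f -> dilatation g -> preserves f m -> preserves g m ->
  ~ inc Z m -> f Z = g Z -> forall Y, inc Y m -> f Y = g Y.
Proof.
move=> df dg fm gm nZm fgZ Y Ym.
have nYZ : Y <> Z by move=> e; apply: nZm; rewrite -e.
have [n [Yn Zn]] := line_through nYZ.
have [p [fZp pn]] := parallel_exists (f Z) n.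
have np := parallel_sym pn.
have npm : ~ parallel p m.
  move=> pm; apply: (not_parallel Ym Yn Zn nZm).
  exact: parallel_sym (parallel_trans np pm).
apply: (@meet_unique _ p m).
- by move=> e; apply: npm; left.
- exact: df np Zn Yn fZp.
- exact: fm.
- by rewrite fgZ in fZp; exact: dg np Zn Yn fZp.
- exact: gm.
Qed.

(** The parallel k to l through X is treated last: its points are reached from
a point off k, where the maps are already known to agree. *)
Lemma dilatations_eq f g l X :
  dilatation f -> dilatation g -> traces f l -> traces g l ->
  f X = g X -> f = g.
Proof.
move=> df dg fl gl fgX.
have [k [Xk kl]] := parallel_exists X l.
have off_k Y : ~ inc Y k -> f Y = g Y.
  move=> nYk; have [m [Ym ml]] := parallel_exists Y l.
  apply: (dilatations_agree_on df dg (fl m ml) (gl m ml) _ fgX Ym) => Xm.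
  apply: nYk.
  by rewrite -(parallel_eq (parallel_trans ml (parallel_sym kl)) Xm Xk).
apply: funext => Y; have [Yk|/off_k//] := pselect (inc Y k).
have [Z nZk] := outside_exists k.
exact: (dilatations_agree_on df dg (fl k kl) (gl k kl) nZk (off_k Z nZk)).
Qed.

Lemma translation_eq f g X :
  translation f -> translation g -> f X = g X -> f = g.
Proof.
move=> tf tg fgX; have [fX|/nesym nfX] := pselect (f X = X).
  by rewrite (tf.2 X fX) (tg.2 X) // -fgX.
have [l [Xl fXl]] := line_through nfX.
have fl := translation_traces tf Xl fXl.
rewrite fgX in fXl; have gl := translation_traces tg Xl fXl.
exact: (dilatations_eq tf.1 tg.1 fl gl fgX).
Qed.

(** When f moves g X back to X, both maps move points in the direction of the
line X (g X); hence so does f \o g, which also fixes X and so is the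
identity. *)
Lemma translation_comp f g :
  translation f -> translation g -> translation (f \o g).
Proof.
move=> tf tg; split=> [|X fgX]; first exact: dilatation_comp tf.1 tg.1.
have [gX|/nesym ngX] := pselect (g X = X).
  rewrite (tg.2 X gX); apply: (tf.2 X).
  by rewrite /= gX in fgX.
have [l [Xl gXl]] := line_through ngX.
have gl := translation_traces tg Xl gXl.
have fl : traces f l by apply: (translation_traces tf gXl); rewrite [f _]fgX.
apply: (dilatations_eq (dilatation_comp tf.1 tg.1) translation_id.1 _
  (@traces_id l) fgX).
by move=> m ml Y Ym; apply: (fl m ml); apply: (gl m ml).
Qed.

(** In two directions, f (g X) and g (f X) are both the fourth vertex of the
parallelogram spanned by X, f X and g X. *)
Lemma commute_crossing f g l m :
  dilatation f -> dilatation g -> traces f l -> traces g m -> ~ parallel l m ->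
  f \o g = g \o f.
Proof.
move=> df dg fl gm nlm; apply: funext => X /=.
have [lX [Xl lXl]] := parallel_exists X l.
have [mX [Xm mXm]] := parallel_exists X m.
have fXl := fl _ lXl _ Xl; have gXm := gm _ mXm _ Xm.
have [l' [gXl' l'l]] := parallel_exists (g X) l.
have [m' [fXm' m'm]] := parallel_exists (f X) m.
apply: (@meet_unique _ l' m').
- move=> e; apply: nlm; apply: parallel_trans m'm.
  by rewrite -e; apply: parallel_sym.
- exact: fl.
- by apply: df Xm gXm fXm'; apply: parallel_trans mXm (parallel_sym m'm).
- by apply: dg Xl fXl gXl'; apply: parallel_trans lXl (parallel_sym l'l).
- exact: gm.
Qed.

End Translations.

(** * Existence of translations *)

Section Parallelograms.
Variable D : desarguesPlane.
Implicit Types (P Q X Y Z : point D) (x y z l m n : line D).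

(** X X' and Y Y' are opposite sides, on the distinct parallel lines x and y.
The degenerate case X = X', Y = Y' is included. *)
Definition parallelogram x y X X' Y Y' : Prop :=
  [/\ parallel x y, x <> y, inc X x /\ inc X' x, inc Y y /\ inc Y' y
    & exists n n', [/\ parallel n n', inc X n, inc Y n, inc X' n' & inc Y' n']].

Lemma parallelogram_sym x y X X' Y Y' :
  parallelogram x y X X' Y Y' -> parallelogram y x Y Y' X X'.
Proof.
by case=> xy nxy Xx Yy [n [n' [? ? ? ? ?]]]; split=> //;
  [apply: parallel_sym | exact: nesym | exists n, n'].
Qed.

Lemma parallelogram_rev x y X X' Y Y' :
  parallelogram x y X X' Y Y' -> parallelogram x y X' X Y' Y.
Proof.
by case=> xy nxy [? ?] [? ?] [n [n' [? ? ? ? ?]]]; split=> //; exists n', n;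
  split=> //; apply: parallel_sym.
Qed.

Lemma parallelogram_exists x y X X' Y :
  parallel x y -> x <> y -> inc X x -> inc X' x -> inc Y y ->
  exists Y', parallelogram x y X X' Y Y'.
Proof.
move=> xy nxy Xx X'x Yy.
have nYx : ~ inc Y x.
  by apply: parallel_notin Yy; [exact: parallel_sym | exact: nesym].
have nXY : X <> Y by move=> e; apply: nYx; rewrite -e.
have [n [Xn Yn]] := line_through nXY.
have [n' [X'n' n'n]] := parallel_exists X' n.
have nn' := parallel_sym n'n.
have [Y' [Y'n' Y'y]] : exists Y', inc Y' n' /\ inc Y' y.
  apply: crossing => n'y; apply: (not_parallel Xx Xn Yn nYx).
  exact: parallel_trans (parallel_trans xy (parallel_sym n'y)) n'n.
by exists Y'; split=> //; exists n, n'.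
Qed.

Lemma parallelogram_uniq x y X X' Y Y' Y'' :
  parallelogram x y X X' Y Y' -> parallelogram x y X X' Y Y'' -> Y' = Y''.
Proof.
case=> xy nxy [Xx X'x] [Yy Y'y] [n [n' [nn' Xn Yn X'n' Y'n']]].
case=> _ _ _ [_ Y''y] [p [p' [pp' Xp Yp X'p' Y''p']]].
have nXY : X <> Y by move=> e; apply: parallel_notin xy nxy Xx _; rewrite e.
have np : n = p by exact: (line_unique nXY).
have n'p' : n' = p'.
  by apply: (@parallel_eq _ _ _ X') => //;
    apply: parallel_trans (parallel_sym nn') _; rewrite np.
rewrite -n'p' in Y''p'; apply: (@meet_unique _ n' y) => // e.
by apply: (parallel_notin xy nxy X'x); rewrite -e.
Qed.

Lemma parallelogram_neq x y X X' Y Y' :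
  parallelogram x y X X' Y Y' -> X <> X' -> Y <> Y'.
Proof.
case=> xy nxy [Xx X'x] [Yy Y'y] [n [n' [nn' Xn Yn X'n' Y'n']]] nXX' YY'.
rewrite -{}YY' in Y'n' Y'y.
have en := parallel_eq nn' Yn Y'n'; rewrite -{}en in X'n'.
by apply: (parallel_notin (parallel_sym xy) (nesym nxy) Yy);
  rewrite (line_unique nXX' Xx X'x Xn X'n').
Qed.

(** The Desargues axiom, which is about joins, as a transitivity law. *)
Lemma parallelogram_trans x y z X X' Y Y' Z Z' :
  X <> X' -> x <> z ->
  parallelogram x y X X' Y Y' -> parallelogram y z Y Y' Z Z' ->
  parallelogram x z X X' Z Z'.
Proof.
move=> nXX' nxz pXY pYZ.
have nYY' := parallelogram_neq pXY nXX'.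
have nZZ' := parallelogram_neq pYZ nYY'.
case: pXY pYZ => xy nxy [Xx X'x] [Yy Y'y] [n [n' [nn' Xn Yn X'n' Y'n']]].
case=> yz nyz _ [Zz Z'z] [p [p' [pp' Yp Zp Y'p' Z'p']]].
have xz := parallel_trans xy yz.
have apart l m P Q : parallel l m -> l <> m -> inc P l -> inc Q m -> P <> Q.
  by move=> lm nlm Pl Qm e; apply: (parallel_notin lm nlm Pl); rewrite e.
have nXY := apart _ _ _ _ xy nxy Xx Yy.
have nX'Y' := apart _ _ _ _ xy nxy X'x Y'y.
have nYZ := apart _ _ _ _ yz nyz Yy Zz.
have nY'Z' := apart _ _ _ _ yz nyz Y'y Z'z.
have nXZ := apart _ _ _ _ xz nxz Xx Zz.
have nX'Z' := apart _ _ _ _ xz nxz X'x Z'z.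
split=> //; exists (join nXZ), (join nX'Z').
split; try by [apply: join_incl | apply: join_incr].
have := @desarguesP D X X' Y Y' Z Z'
  nXX' nYY' nZZ' nXY nX'Y' nYZ nY'Z' nXZ nX'Z'.
rewrite (joinE nXX' Xx X'x) (joinE nYY' Yy Y'y) (joinE nZZ' Zz Z'z).
rewrite (joinE nXY Xn Yn) (joinE nX'Y' X'n' Y'n').
by rewrite (joinE nYZ Yp Zp) (joinE nY'Z' Y'p' Z'p'); apply.
Qed.

(** With a point off a and k, an auxiliary side N N' on a third line reduces
the claim to the transitivity law. Without one, a = {A, A'} and k = {K, K'},
and the four vertices leave no choice. *)
Lemma parallelogram_two_lines a k A A' K K' Y Y' Z Z' :
  A <> A' -> parallelogram a k A A' K K' -> parallelogram a k A A' Y Y' ->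
  parallelogram k a K K' Z Z' -> parallelogram k a Y Y' Z Z'.
Proof.
move=> nAA' pAK pAY pKZ.
have nKK' := parallelogram_neq pAK nAA'.
have nYY' := parallelogram_neq pAY nAA'.
have nZZ' := parallelogram_neq pKZ nKK'.
have [ak nak [Aa A'a] [Kk K'k] _] := pAK.
have [[N [nNa nNk]]|cov] := pselect (exists N, ~ inc N a /\ ~ inc N k).
  have [n [Nn na]] := parallel_exists N a.
  have an := parallel_sym na.
  have nan : a <> n by move=> e; apply: nNa; rewrite e.
  have nkn : k <> n by move=> e; apply: nNk; rewrite e.
  have [N' pAN] := parallelogram_exists an nan Aa A'a Nn.
  have pNA := parallelogram_sym pAN.
  have nNN' := parallelogram_neq pAN nAA'.
  have pNK := parallelogram_trans nNN' (nesym nkn) pNA pAK.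
  have pNY := parallelogram_trans nNN' (nesym nkn) pNA pAY.
  have pNZ := parallelogram_trans nNN' (nesym nan) pNK pKZ.
  exact: parallelogram_trans nYY' (nesym nak) (parallelogram_sym pNY) pNZ.
have {}cov P : inc P a \/ inc P k.
  by apply: contrapT => /not_orP n; apply: cov; exists P.
have [_ _ _ [Yk Y'k] _] := pAY; have [_ _ _ [Za Z'a] _] := pKZ.
have in_a X : inc X a -> X = A \/ X = A'.
  by move=> Xa; apply: (covered_line ak nak cov nAA' Aa A'a Kk Xa).
have in_k X : inc X k -> X = K \/ X = K'.
  move=> Xk.
  apply: (covered_line (parallel_sym ak) (nesym nak) _ nKK' Kk K'k Aa Xk).
  by move=> P; case: (cov P); [right | left].
have [YK|YK'] := in_k Y Yk.
  by rewrite {}YK in pAY *; rewrite -(parallelogram_uniq pAK pAY).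
have [ZA|ZA'] := in_a Z Za.
  rewrite {}ZA in pKZ *.
  rewrite -(parallelogram_uniq (parallelogram_sym pAK) pKZ).
  exact: parallelogram_sym.
have Y'K : Y' = K by case: (in_k Y' Y'k) => // e; case: nYY'; rewrite YK' e.
have Z'A : Z' = A by case: (in_a Z' Z'a) => // e; case: nZZ'; rewrite ZA' e.
by rewrite YK' Y'K ZA' Z'A; apply/parallelogram_rev/parallelogram_sym.
Qed.

(** For Y off the line a = AA' the image Y' completes a parallelogram on A A';
the points of a itself are reached through a second side K K' off a. *)
Lemma translation_exists A A' :
  exists f : point D -> point D, translation f /\ f A = A'.
Proof.
have [<-|nAA'] := pselect (A = A').
  by exists id; split=> //; exact: translation_id.
have [a [Aa A'a]] := line_through nAA'.
have [K nKa] := outside_exists a.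
have [k [Kk ka]] := parallel_exists K a.
have ak := parallel_sym ka.
have nak : a <> k by move=> e; apply: nKa; rewrite e.
have [K' pAK] := parallelogram_exists ak nak Aa A'a Kk.
have pKA := parallelogram_sym pAK.
have nKK' := parallelogram_neq pAK nAA'.
have [_ _ _ [_ K'k] _] := pAK.
pose R y Y Y' := parallelogram a y A A' Y Y' \/ parallelogram k y K K' Y Y'.
have /choice[f fP] Y : exists Y', exists y, R y Y Y'.
  have [y [Yy ya]] := parallel_exists Y a; have ay := parallel_sym ya.
  have [e|nay] := pselect (a = y).
    rewrite -{}e in Yy.
    have [Y' pY] := parallelogram_exists ka (nesym nak) Kk K'k Yy.
    by exists Y', a; right.
  have [Y' pY] := parallelogram_exists ay nay Aa A'a Yy.
  by exists Y', y; left.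
have move_all y Y Y' : R y Y Y' -> Y <> Y'.
  by case=> /parallelogram_neq; apply.
have along y Y Y' : R y Y Y' -> parallel y a /\ (inc Y y /\ inc Y' y).
  case=> -[py _ _ ? _]; split=> //; first exact: parallel_sym.
  by apply: parallel_trans (parallel_sym py) ka.
(* Transitivity compares Y and Z through A or K, except when one of them lies on
k and the other on a; only then is the comparison on two lines needed. *)
have both y z Y Y' Z Z' : y <> z -> R y Y Y' -> R z Z Z' ->
    parallelogram y z Y Y' Z Z'.
  have mixed u v U U' V V' : u <> v -> parallelogram a u A A' U U' ->
      parallelogram k v K K' V V' -> parallelogram u v U U' V V'.
    move=> nuv pAU pKV; have pUA := parallelogram_sym pAU.
    have nUU' := parallelogram_neq pAU nAA'.
    have nVV' := parallelogram_neq pKV nKK'.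
    have [ku|nku] := pselect (k = u); last first.
      have pKU := parallelogram_trans nKK' nku pKA pAU.
      exact: parallelogram_trans nUU' nuv (parallelogram_sym pKU) pKV.
    have [av|nav] := pselect (a = v); last first.
      have pAV := parallelogram_trans nAA' nav pAK pKV.
      exact: parallelogram_trans nUU' nuv pUA pAV.
    rewrite -{u}ku in nuv pAU pUA *; rewrite -{v}av in nuv pKV *.
    exact: parallelogram_two_lines nAA' pAK pAU pKV.
  move=> nyz [pAY|pKY] [pAZ|pKZ].
  - have nYY' := parallelogram_neq pAY nAA'.
    exact: parallelogram_trans nYY' nyz (parallelogram_sym pAY) pAZ.
  - exact: mixed.
  - by apply/parallelogram_sym/mixed => //; exact: nesym.
  - have nYY' := parallelogram_neq pKY nKK'.
    exact: parallelogram_trans nYY' nyz (parallelogram_sym pKY) pKZ.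
exists f; split; last first.
  (* A lies on a, so its image was obtained from K K'. *)
  have [y [[ay nay _ [Ay _] _]|pKfA]] := fP A.
    by case: (parallel_notin ay nay Aa).
  have ya : y = a.
    have [ya [Ay _]] := along _ _ _ (or_intror pKfA : R y A (f A)).
    exact: parallel_eq ya Ay Aa.
  by rewrite ya in pKfA; exact: parallelogram_uniq pKfA pKA.
split=> [l m X Y lm Xl Yl fXm|X fX]; last first.
  by have [x /move_all/nesym] := fP X.
have [x RX] := fP X; have [y RY] := fP Y.
have [xa [Xx fXx]] := along _ _ _ RX; have [ya [Yy fYy]] := along _ _ _ RY.
have [xy|nxy] := pselect (x = y).
  rewrite -{}xy in ya Yy fYy.
  have [<-//|nXY] := pselect (X = Y).
  have lx : l = x by exact: (line_unique nXY).
  by rewrite -(parallel_eq lm _ fXm) // lx.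
have [_ _ _ _ [n [n' [nn' Xn Yn fXn' fYn']]]] := both _ _ _ _ _ _ nxy RX RY.
have nXY : X <> Y.
  move=> e; apply: nxy; apply: (parallel_eq _ Xx); last by rewrite e.
  exact: parallel_trans xa (parallel_sym ya).
have ln : l = n by exact: (line_unique nXY).
rewrite ln in lm.
by rewrite (parallel_eq (parallel_trans (parallel_sym lm) nn') fXm fXn').
Qed.

End Parallelograms.

(** * The group of points of a line *)

Section Addition.
Variable D : desarguesPlane.
Implicit Types (l m : line D) (f g h : point D -> point D).

(** For f and g in the same direction, let h have another direction. Then
g \o h also has another direction than f, so f commutes with h and with
g \o h; now cancel h. *)
Lemma translation_comm f g : translation f -> translation g -> f \o g = g \o f.
Proof.
move=> tf tg.
have [[X fX]|nf] := pselect (exists X, f X = X); first by rewrite (tf.2 X fX).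
have [[X gX]|ng] := pselect (exists X, g X = X); first by rewrite (tg.2 X gX).
have dir f' : translation f' -> ~ (exists X, f' X = X) ->
    forall X, exists l, [/\ inc X l, inc (f' X) l & traces f' l].
  move=> tf' nf' X; have nX : X <> f' X by move=> e; apply: nf'; exists X.
  have [l [Xl fXl]] := line_through nX.
  by exists l; split=> //; apply: translation_traces Xl fXl.
have [X _] : exists X : point D, True.
  by have [P _] := A3 D; exists P.
have [l [Xl fXl fl]] := dir f tf nf X.
have [m [Xm gXm gm]] := dir g tg ng X.
have [lm|nlm] := pselect (parallel l m); last first.
  exact: commute_crossing tf.1 tg.1 fl gm nlm.
have {m Xm lm gm gXm} gl : traces g l by exact: traces_parallel lm gm.
have [Q nQl] := outside_exists l.
have [h [th hX]] := translation_exists X Q.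
(* Every translation taking X off l commutes with f. *)
have comm_off k : translation k -> ~ inc (k X) l -> f \o k = k \o f.
  move=> tk nkX; have nk : ~ exists Y, k Y = Y.
    by case=> Y /tk.2 kid; apply: nkX; rewrite kid.
  have [n [Xn kXn kn]] := dir k tk nk X.
  exact: commute_crossing tf.1 tk.1 fl kn (not_parallel Xl Xn kXn nkX).
have fh : f \o h = h \o f by apply: comm_off; rewrite ?hX.
have fgh : f \o (g \o h) = (g \o h) \o f.
  apply: comm_off; first exact: translation_comp.
  have [q [Qq ql]] := parallel_exists Q l.
  rewrite /= hX => gQl; apply: nQl.
  by rewrite -(parallel_eq ql (gl q ql Q Qq) gQl).
have tfg := translation_comp tf tg; have tgf := translation_comp tg tf.
apply: (translation_eq tfg tgf (X := h X)).
by rewrite -[LHS]/((f \o (g \o h)) X) fgh -[RHS]/((g \o (f \o h)) X) fh.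
Qed.

Definition translation_from (O A : point D) : point D -> point D :=
  projT1 (cid (translation_exists O A)).

Lemma translation_fromP O A :
  translation (translation_from O A) /\ translation_from O A O = A.
Proof. by rewrite /translation_from; case: cid. Qed.

Lemma translation_fromE O f : translation f -> translation_from O (f O) = f.
Proof.
have [t tO] := translation_fromP O (f O).
by move=> tf; apply: translation_eq t tf tO.
Qed.

(** In the construction P1 is the image of B1, and C that of B. *)
Lemma sum_constructionE (O I : point D) (nOI : O <> I)
    (A B C : points_on (join nOI)) (B1 : point D) (nB1 : ~ inc B1 (join nOI)) :
  sum_construction A B nB1 C -> sval C = translation_from O (sval A) (sval B).
Proof.
case=> P1 [P1P CP].
have [t tO] := translation_fromP O (sval A).
set f := translation_from O (sval A) in t tO *.
have image l P Q : inc P l -> inc Q l -> inc (f Q) (parallel_through (f P) l).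
  move=> Pl Ql; have [fPm ml] := parallel_throughP (f P) l.
  exact: t.1 (parallel_sym ml) Pl Ql fPm.
have traces_OI : traces f (join nOI).
  apply: (translation_traces t (join_incl nOI)).
  by rewrite tO; exact: (proj2_sig A).
have fB1 : f B1 = P1.
  apply/P1P; split.
    have [B1m mOI] := parallel_throughP B1 (join nOI).
    exact: traces_OI mOI _ B1m.
  by rewrite -tO; apply: image; [apply: join_incl | apply: join_incr].
symmetry; apply/CP; split.
  by rewrite -fB1; apply: image; [apply: join_incr | apply: join_incl].
by apply: (traces_OI _ _ _ (proj2_sig B)); left.
Qed.

Lemma addE (O I : point D) (nOI : O <> I) (A B : points_on (join nOI)) :
  sval (add A B) = translation_from O (sval A) (sval B).
Proof.
by rewrite /add; case: cid => C [B1 [nB1 CP]]; apply: sum_constructionE CP.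
Qed.

Lemma translation_from_add (O I : point D) (nOI : O <> I)
    (A B : points_on (join nOI)) :
  translation_from O (sval (add A B)) =
  translation_from O (sval A) \o translation_from O (sval B).
Proof.
have [tA _] := translation_fromP O (sval A).
have [tB BO] := translation_fromP O (sval B).
by rewrite -(translation_fromE O (translation_comp tA tB)) /= BO addE.
Qed.

Lemma points_on_inj l (A B : points_on l) : sval A = sval B -> A = B.
Proof.
case: A B => [A Al] [B Bl] /= AB; rewrite {}AB in Al *.
by rewrite (Prop_irrelevance Al Bl).
Qed.

End Addition.

Theorem theorem3p1 (D : desarguesPlane) (O I : point D) (nOI : O <> I) :
  abelian_group (@add D O I nOI).
Proof.
have addC : commutative (@add D O I nOI).
  move=> A B; apply: points_on_inj.
  have [tA AO] := translation_fromP O (sval A).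
  have [tB BO] := translation_fromP O (sval B).
  have := congr1 (fun f => f O) (translation_comm tA tB).
  by rewrite /= AO BO !addE.
split=> //.
  move=> A B C; apply: points_on_inj.
  by rewrite [RHS]addE translation_from_add !addE.
pose e : points_on (join nOI) := exist _ O (join_incl nOI).
have add0 : left_id e (@add D O I nOI).
  move=> A; apply: points_on_inj.
  by rewrite addE (translation_fromE O (@translation_id D)).
exists e; split=> // [A|A]; first by rewrite addC add0.
have [g [tg gA]] := translation_exists (sval A) O.
have gO : inc (g O) (join nOI).
  have gAO : inc (g (sval A)) (join nOI) by rewrite gA; exact: join_incl.
  exact: dilatation_preserves tg.1 (proj2_sig A) gAO _ (join_incl nOI).
pose B : points_on (join nOI) := exist _ (g O) gO.
have AB : add A B = e.
  apply: points_on_inj; have [tA AO] := translation_fromP O (sval A).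
  rewrite addE -[LHS]/((translation_from O (sval A) \o g) O).
  by rewrite (translation_comm tA tg) /= AO.
by exists B; rewrite -[add B A]addC.
Qed.
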